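(* Let $\mu$ be a symmetric probability measure on $\mathbb{R}$ such that $m_1(\mu)=0$, $m_2(\mu)=1$, $m_4(\mu)<+\infty$ and $m_{-2}(\mu)<+\infty$. For $n\ge1$ let $\mu_n$ be the dilation of $\mu^{\uplus n}$ by $\frac1{\sqrt n}$, i.e. $\mu_n(A)=\mu^{\uplus n}\left(\{x:\frac1{\sqrt n}x\in A\}\right)$ for Borel sets $A$. Then, as $n\to\infty$, $$\Gamma(\mu_n|\mathrm{b})=O\left(\frac{\log(n)}{n}\right).$$
   Context: $\mathrm{b}=\frac12\delta_{-1}+\frac12\delta_{1}$ is the Rademacher distribution; $m_k(\mu)=\int x^k\,d\mu(x)$ for $k\in\mathbb{Z}$. The Boolean entropy of $\mu$ relative to $\mathrm{b}$ is $\Gamma(\mu|\mathrm{b})=\frac12\int x^2\,d\mu(x)-\int\log|x|\,d\mu(x)-\frac12\in[0,+\infty]$. For a probability measure $\mu$ on $\mathbb{R}$ and $z$ in the upper half-plane, let $G_\mu(z)=\int\frac{1}{z-x}\,d\mu(x)$ and $K_\mu(z)=z-1/G_\mu(z)$. The Boolean convolution $\mu\uplus\nu$ of two probability measures on $\mathbb{R}$ is the unique probability measure with $K_{\mu\uplus\nu}(z)=K_\mu(z)+K_\nu(z)$ for all $z$ with $\Im z>0$; $\mu^{\uplus n}$ is the $n$-fold Boolean convolution of $\mu$ with itself. *)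

(* Defs.v *)
From HB Require Import structures.
From mathcomp Require Import all_boot all_order all_algebra.
From mathcomp Require Import complex.
From mathcomp Require Import all_classical all_reals all_analysis.
From mathcomp Require Import measurable_realfun.

Set Implicit Arguments.
Unset Strict Implicit.
Unset Printing Implicit Defensive.

Import Order.TTheory GRing.Theory Num.Theory.
Import numFieldNormedType.Exports.

Local Open Scope classical_set_scope.
Local Open Scope ring_scope.

Notation prob R := (probability (measurableTypeR R) R).

Definition symmetric_prob (R : realType) (mu : prob R) : Prop :=
  forall A : set (measurableTypeR R),
    measurable A -> mu [set x | A (- x)] = mu A.

(* [x ^ k] with values in the extended reals.  The inverse is taken in [\bar R],
   where 0^-1 = +oo (in the field R it would be 0), so an atom of mu at 0 makes
   the negative even moments infinite. *)
Definition epowz (R : realType) (x : R) (k : int) : \bar R :=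
  match k with
  | Posz n => (x%:E ^+ n)%E
  | Negz n => ((x%:E)^-1 ^+ n.+1)%E
  end.

Definition moment (R : realType) (mu : prob R) (k : int) : \bar R :=
  (\int[mu]_x epowz x k)%E.

(* [lne 0 = -oo], whereas the real-valued [ln 0] is 0.  If the two integrals
   are both +oo, the difference takes the library's value -oo. *)
Definition boolean_entropy (R : realType) (mu : prob R) : \bar R :=
  ((2^-1)%:E * moment mu 2 - (\int[mu]_x lne (`|x|%:E)) - (2^-1)%:E)%E.

(* The complex-valued integral is taken componentwise; for Im z > 0 the
   integrand is bounded. *)
Definition cauchy_transform (R : realType) (mu : prob R) (z : R[i]) : R[i] :=
  Complex (\int[mu]_x complex.Re (1 / (z - (x%:C)%C)))
          (\int[mu]_x complex.Im (1 / (z - (x%:C)%C))).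

Definition K_transform (R : realType) (mu : prob R) (z : R[i]) : R[i] :=
  z - 1 / cauchy_transform mu z.

(* [rho] is the Boolean convolution of [mu] and [nu].  The K-transform
   determines a probability measure on Borel sets, so this pins down [rho]. *)
Definition is_boolean_convolution (R : realType) (mu nu rho : prob R) : Prop :=
  forall z : R[i], 0 < complex.Im z ->
    K_transform rho z = K_transform mu z + K_transform nu z.

(* For n >= 1, [nu n] is the n-fold Boolean convolution of [mu] with itself;
   [nu 0] is unconstrained. *)
Definition is_boolean_powers (R : realType) (mu : prob R) (nu : nat -> prob R)
    : Prop :=
  (forall A : set (measurableTypeR R), measurable A -> nu 1%N A = mu A) /\
  (forall n : nat, (0 < n)%N -> is_boolean_convolution (nu n) mu (nu n.+1)).

Definition scale (R : realType) (c : R) (x : measurableTypeR R)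
  : measurableTypeR R := c * x.

Lemma measurable_scale (R : realType) (c : R) : measurable_fun setT (scale c).
Proof. exact: mulrl_measurable. Qed.

HB.instance Definition _ (R : realType) (c : R) :=
  isMeasurableFun.Build _ _ _ _ (scale c) (measurable_scale c).

Definition dilation (R : realType) (c : R) (mu : prob R) : prob R :=
  distribution mu (scale c).

(* Main.v *)
(* With t = x^2, the integrand (t - 1)/2 - ln(t)/2 of the entropy lies between 0
   and (1 + 2 ln n)(t - 1)^2 + 1/(2nt), so the entropy of mu_n is O(ln n / n) as
   soon as int (x^2 - 1)^2 dmu_n = O(1/n) and m_{-2}(mu_n) = O(1).  Both follow
   from the Cauchy transform on the imaginary axis: with
   S_P(s) = int 1/(x^2 + s) dP, symmetry of mu and z = i sqrt(s), the Boolean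
   powers satisfy 1/S_{nu n}(s) - s = n (1/S_mu(s) - s).  Letting s tend to
   +oo (resp. 0) and applying Fatou's lemma bounds the positive (resp. negative)
   moments of nu n. *)
Require Import Defs.
From mathcomp Require Import all_boot all_order all_algebra.
From mathcomp Require Import complex.
From mathcomp Require Import all_classical all_reals all_analysis.
From mathcomp Require Import measurable_realfun ring lra.
Import Order.TTheory GRing.Theory Num.Theory.
Import numFieldNormedType.Exports.
Local Open Scope classical_set_scope.
Local Open Scope ring_scope.

(** * Integrability of bounded functions and a Fatou bound *)

Lemma bounded_integrable (R : realType) (P : prob R) (f : R -> R) (C : R) :
  measurable_fun setT f -> (forall x, `|f x| <= C) ->
  P.-integrable setT (EFin \o f).
Proof.
move=> mf fC.
apply: (@le_integrable _ _ _ P setT measurableT _ (EFin \o cst C)).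
- exact/measurable_EFinP.
- by move=> x _ /=; rewrite lee_fin (le_trans (fC x))// ler_norm.
- exact: finite_measure_integrable_cst.
Qed.

Lemma fatou_cvg (R : realType) (P : prob R) (f : (R -> \bar R)^nat)
    (g : R -> \bar R) (C : \bar R) :
  (forall n, measurable_fun setT (f n)) ->
  (forall n x, 0 <= f n x)%E ->
  (forall x, f n x @[n --> \oo] --> g x) ->
  (\forall n \near \oo, (\int[P]_x f n x <= C)%E) ->
  (\int[P]_x g x <= C)%E.
Proof.
move=> mf f0 fg [N _ fC].
(* The integrals are bounded only from rank [N] on, so Fatou is applied to the sequence shifted by
   [N]. *)
have -> : (\int[P]_x g x = \int[P]_x (limn_einf (fun n => f (n + N)%N x)))%E.
  apply: eq_integral => x _.
  have fNg : f (n + N)%N x @[n --> \oo] --> g x.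
    by have := fg x; rewrite -(cvg_shiftn N).
  by rewrite is_cvg_limn_einfE; [exact/esym/cvg_lim|apply/cvg_ex; exists (g x)].
apply: (le_trans (fatou P measurableT (fun n => mf (n + N)%N) _)) => //.
rewrite limn_einf_lim; apply: lime_le; first exact: is_cvg_einfs.
apply: nearW => n; apply: ge_ereal_inf => /=.
exists (\int[P]_x f (n + N)%N x)%E; first by exists n => /=.
by apply: fC => /=; rewrite leq_addl.
Qed.

Lemma measurable_inv_sqrD (R : realType) (s : R) : 0 < s ->
  measurable_fun setT (fun x : R => (x ^+ 2 + s)^-1).
Proof.
move=> s0; apply: continuous_measurable_fun => x.
apply: cvgV; first by rewrite gt_eqF// ltr_wpDl ?sqr_ge0.
by apply: cvgD; [exact: exprn_continuous|exact: cvg_cst].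
Qed.

(** * The kernel [1 / (x ^ 2 + s)] and its integral *)

Section kernel.
Context {R : realType} (P : prob R).

(** The Stieltjes transform, at [- s], of the law of [x ^ 2] under [P]. *)
Definition stieltjes (s : R) : R := \int[P]_x (x ^+ 2 + s)^-1.

Lemma kernel_bound (x s : R) : 0 < s -> 0 < (x ^+ 2 + s)^-1 <= s^-1.
Proof.
move=> s0; have xs : 0 < x ^+ 2 + s by rewrite ltr_wpDl ?sqr_ge0.
by rewrite invr_gt0 xs/= lef_pV2 ?posrE// lerDr sqr_ge0.
Qed.

Lemma kernel_ge0 (x s : R) : 0 < s -> 0 <= (x ^+ 2 + s)^-1.
Proof. by move=> s0; have /andP[/ltW] := kernel_bound x s s0. Qed.

Lemma kernel_integrable (s : R) : 0 < s ->
  P.-integrable setT (EFin \o (fun x : R => (x ^+ 2 + s)^-1)).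
Proof.
move=> s0; apply: (@bounded_integrable _ _ _ s^-1).
  exact: measurable_inv_sqrD.
by move=> x; have /andP[k0 ks] := kernel_bound x s s0; rewrite gtr0_norm.
Qed.

Lemma stieltjesE (s : R) : 0 < s ->
  (\int[P]_x ((x ^+ 2 + s)^-1)%:E = (stieltjes s)%:E)%E.
Proof.
move=> s0; rewrite /stieltjes /Rintegral fineK//.
exact: (integrable_fin_num measurableT (kernel_integrable s s0)).
Qed.

Lemma integral_cst1 (c : R) : (\int[P]_x c%:E = c%:E)%E.
Proof. by rewrite integral_cst//= probability_setT mule1. Qed.

Lemma stieltjes_le (s : R) : 0 < s -> stieltjes s <= s^-1.
Proof.
move=> s0; rewrite -lee_fin -stieltjesE// -(integral_cst1 s^-1).
apply: ge0_le_integral => //.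
- by move=> x _; rewrite lee_fin kernel_ge0.
- by apply/measurable_EFinP; exact: measurable_inv_sqrD.
- by move=> x _; rewrite lee_fin; have /andP[] := kernel_bound x s s0.
Qed.

(** A zero integral would make the kernel vanish almost everywhere; as it is positive everywhere,
    the whole space would be a null set. *)
Lemma stieltjes_gt0 (s : R) : 0 < s -> 0 < stieltjes s.
Proof.
move=> s0; rewrite lt_neqAle; apply/andP; split; last first.
  by apply: Rintegral_ge0 => x _; exact: kernel_ge0.
apply/eqP => /esym S0.
have /(ae_eq_integral_abs P measurableT _).1 :
    (\int[P]_x `|((x ^+ 2 + s)^-1)%:E| = 0)%E.
  rewrite -[RHS]/(0%:E) -S0 -stieltjesE//; apply: eq_integral => x _ /=.
  by have /andP[k0 _] := kernel_bound x s s0; rewrite gtr0_norm.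
case.
  by apply/measurable_EFinP; exact: measurable_inv_sqrD.
move=> A [mA PA0 /(_ _ _)/= subA].
have AT : A = setT.
  rewrite -subTset => x _; apply: subA => /(_ I)[] /eqP.
  by have /andP[k0 _] := kernel_bound x s s0; rewrite gt_eqF.
have /eqP : P setT = 0%E by rewrite -AT.
by rewrite probability_setT onee_eq0.
Qed.

End kernel.

(** * The Cauchy transform on the imaginary axis *)

Lemma invc_imag_sub (R : realType) (x y : R) :
  1 / (Complex 0 y - (x%:C)%C) =
  Complex (- x / (x ^+ 2 + y ^+ 2)) (- (y / (x ^+ 2 + y ^+ 2))).
Proof.
by rewrite div1r; congr Complex; rewrite /= ?oppr0 ?add0r ?addr0 sqrrN.
Qed.

Lemma cauchy_transform_imag (R : realType) (P : prob R) (y : R) : 0 < y ->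
  cauchy_transform P (Complex 0 y) =
  Complex (\int[P]_x (- x / (x ^+ 2 + y ^+ 2))) (- y * stieltjes P (y ^+ 2)).
Proof.
move=> y0; rewrite /stieltjes -RintegralZl//; last first.
  by apply: kernel_integrable; rewrite exprn_gt0.
congr Complex; apply: eq_Rintegral => x _; first by rewrite invc_imag_sub.
by rewrite invc_imag_sub /= mulNr.
Qed.

(** Symmetry makes [P] its own pushforward under negation, so the integral of an odd function equals
    its opposite. *)
Lemma symmetric_odd_integral (R : realType) (P : prob R) (f : R -> R) (C : R) :
  symmetric_prob P -> measurable_fun setT f -> (forall x, `|f x| <= C) ->
  (forall x, f (- x) = - f x) -> \int[P]_x f x = 0.
Proof.
move=> symP mf fC fN.
have mN : measurable_fun (setT : set (measurableTypeR R))
    (-%R : measurableTypeR R -> measurableTypeR R) by exact: oppr_measurable.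
have fint := bounded_integrable _ P f C mf fC.
have H : (\int[P]_x (f x)%:E = \int[P]_x (- f x)%:E)%E.
  transitivity (\int[pushforward P (-%R : measurableTypeR R -> measurableTypeR R)]_x
                  (f x)%:E)%E.
    by apply: eq_measure_integral => A mA _; exact/esym/symP.
  rewrite integral_pushforward//=; last 2 first.
  - exact/measurable_EFinP.
  - apply: (@bounded_integrable _ P (f \o -%R) C); first exact: measurableT_comp.
    by move=> x /=.
  by apply: eq_integral => x _ /=; rewrite fN.
have : \int[P]_x f x = - \int[P]_x f x.
  rewrite {1}/Rintegral H.
  under eq_integral do rewrite EFinN.
  rewrite integralN/=; last exact: integrable_add_def.
  by rewrite fineN.
by move=> ?; lra.
Qed.

Lemma symmetric_cauchy_transform_imag (R : realType) (P : prob R) (y : R) :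
  0 < y -> symmetric_prob P ->
  cauchy_transform P (Complex 0 y) = Complex 0 (- y * stieltjes P (y ^+ 2)).
Proof.
move=> y0 symP; have y20 : 0 < y ^+ 2 by rewrite exprn_gt0.
rewrite cauchy_transform_imag//; congr Complex.
(* The bound [y^-1] comes from [y * |x| <= x ^ 2 + y ^ 2]. *)
apply: (@symmetric_odd_integral _ P _ y^-1) => //.
- by apply: measurable_funM; [exact: oppr_measurable|exact: measurable_inv_sqrD].
- move=> x; rewrite normrM normrN.
  have xy0 : 0 < x ^+ 2 + y ^+ 2 by rewrite ltr_wpDl ?sqr_ge0.
  rewrite (gtr0_norm (_ : 0 < _^-1)) ?invr_gt0//.
  rewrite ler_pdivrMr// ler_pdivlMl// -(real_normK (num_real x)).
  by have := normr_ge0 x; nra.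
- by move=> x; rewrite sqrrN mulNr.
Qed.

(** * Boolean powers on the imaginary axis *)

Section boolean_powers.
Context {R : realType} (mu : prob R) (nu : nat -> prob R).
Hypotheses (mu_sym : symmetric_prob mu) (nu_powers : is_boolean_powers mu nu).

Lemma K_transform_imag (y : R) : 0 < y ->
  K_transform mu (Complex 0 y) =
  Complex 0 (y - (y * stieltjes mu (y ^+ 2))^-1).
Proof.
move=> y0; have S0 := stieltjes_gt0 mu (y ^+ 2) (exprn_gt0 2 y0).
rewrite /K_transform.
rewrite symmetric_cauchy_transform_imag// div1r.
congr Complex; rewrite /= ?mul0r ?subr0 ?oppr0//.
by field; rewrite !gt_eqF.
Qed.

Lemma K_transform_powers (n : nat) (y : R) : 0 < y ->
  K_transform (nu n.+1) (Complex 0 y) =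
  Complex 0 (n.+1%:R * (y - (y * stieltjes mu (y ^+ 2))^-1)).
Proof.
move=> y0; have [nu1 nuS] := nu_powers.
elim: n => [|n IH].
  rewrite mul1r -K_transform_imag// /K_transform /cauchy_transform /Rintegral.
  by congr (_ - 1 / Complex (fine _) (fine _));
    apply: eq_measure_integral => A mA _; exact: nu1.
rewrite nuS//= IH K_transform_imag//=.
by congr Complex; [rewrite addr0|rewrite -[n.+2]addn1 natrD mulrDl mul1r].
Qed.

(** At [z = i y] with [y ^ 2 = s], additivity of the K-transform becomes a real identity. It encodes
    the n.+1-fold Boolean power without describing the measure [nu n.+1] itself. *)
Lemma stieltjes_powers (n : nat) (s : R) : 0 < s ->
  (stieltjes (nu n.+1) s)^-1 = s + n.+1%:R * ((stieltjes mu s)^-1 - s).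
Proof.
move=> s0; pose y := Num.sqrt s.
have y0 : 0 < y by rewrite sqrtr_gt0.
have ys : s = y ^+ 2 by rewrite sqr_sqrtr// ltW.
have := K_transform_powers n y y0.
rewrite /K_transform cauchy_transform_imag// -ys.
have S0 := stieltjes_gt0 mu s s0; have Sn0 := stieltjes_gt0 (nu n.+1) s s0.
move: (Rintegral _ _ _) => a; rewrite div1r => -[].
set b' := - y * _; have b'0 : b' < 0 by rewrite /b' mulNr oppr_lt0 mulr_gt0.
have d0 : 0 < a ^+ 2 + b' ^+ 2.
  by rewrite ltr_wpDl ?sqr_ge0// exprn_even_gt0//= lt_eqF.
(* Symmetry is given for [mu] only. That the real part [a] of the Cauchy transform of [nu n.+1]
   vanishes is read off from its K-transform being purely imaginary here. *)
move=> /eqP; rewrite sub0r oppr_eq0 mulf_eq0 invr_eq0 (gt_eqF d0) orbF => /eqP a0.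
rewrite a0 expr0n add0r => /(congr1 ( *%R y)).
rewrite (_ : y * (y - _) = s - (stieltjes (nu n.+1) s)^-1); last first.
  by rewrite /b' ys; field; rewrite -?ys !gt_eqF.
rewrite (_ : y * (_ * _) = n.+1%:R * (s - (stieltjes mu s)^-1)); last first.
  by rewrite ys; field; rewrite -?ys !gt_eqF.
by move=> ?; lra.
Qed.

End boolean_powers.

(** * Pointwise limits that recover moments from the kernel *)

Lemma epowzN2E (R : realType) (x : R) :
  epowz x (- 2) = if x == 0 then +oo%E else (x ^- 2)%:E.
Proof.
rewrite /epowz /= inver; case: ifPn => _; first by rewrite mulyy.
by rewrite -EFinM -invfM -expr2.
Qed.

Lemma epowzN2_ge0 (R : realType) (x : R) : (0 <= epowz x (- 2))%E.
Proof.
by rewrite epowzN2E; case: ifPn => // _; rewrite lee_fin invr_ge0 sqr_ge0.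
Qed.

(** At [x = 0] the terms are [n + 1] and tend to [+oo], the value of [epowz 0 (- 2)], so Fatou's
    lemma will also see an atom at 0. *)
Lemma cvg_epowzN2 (R : realType) (x : R) :
  ((x ^+ 2 + harmonic n)^-1)%:E @[n --> \oo] --> epowz x (- 2).
Proof.
rewrite epowzN2E; case: ifPn => [/eqP ->|x0].
  rewrite expr0n /=; apply/cvgeryP.
  under eq_fun do rewrite add0r invrK.
  by have := @cvgr_idn R; rewrite -(cvg_shiftS (fun n => n%:R : R)).
apply: cvg_EFin; first exact: nearW.
rewrite -[X in (X)^-1]addr0; apply: cvgV; first by rewrite addr0 sqrf_eq0.
by apply: cvgD; [exact: cvg_cst|exact: cvg_harmonic].
Qed.

Lemma measurable_epowzN2 (R : realType) :
  measurable_fun setT (fun x : R => epowz x (- 2)).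
Proof.
apply: (@emeasurable_fun_cvg _ _ _ _
    (fun n (x : R) => ((x ^+ 2 + harmonic n)^-1)%:E)).
  move=> n; apply/measurable_EFinP; apply: measurable_inv_sqrD.
  exact: harmonic_gt0.
by move=> x _; exact: cvg_epowzN2.
Qed.

(** The weight [k / (x ^ 2 + k)], with [k = n.+1], is a smooth truncation: it turns positive moments
    into limits of kernel integrals. *)
Lemma cvg_kernel1 (R : realType) (a x : R) :
  (a * (n.+1%:R * (x ^+ 2 + n.+1%:R)^-1))%:E @[n --> \oo] --> a%:E.
Proof.
apply: cvg_EFin; first exact: nearW.
rewrite -[X in _ --> X]mulr1; apply: cvgM; first exact: cvg_cst.
rewrite (_ : (fun n => _) = (fun n => (x ^+ 2 * harmonic n + 1)^-1)); last first.
  apply/funext => n; have n0 : 0 < n.+1%:R :> R by rewrite ltr0n.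
  have d0 : 0 < x ^+ 2 + n.+1%:R by rewrite ltr_wpDl ?sqr_ge0.
  have e : x ^+ 2 * harmonic n + 1 = (x ^+ 2 + n.+1%:R) / n.+1%:R.
    by rewrite /harmonic /= mulrDl divff// gt_eqF.
  by rewrite e invf_div.
rewrite -[X in _ --> X]invr1 -[X in (X)^-1]add0r.
apply: cvgV; first by rewrite add0r oner_eq0.
apply: cvgD; last exact: cvg_cst.
rewrite -(mulr0 (x ^+ 2)); apply: cvgM; first exact: cvg_cst.
exact: cvg_harmonic.
Qed.

(** * Kernel integrals in terms of [stieltjes] *)

Section moments.
Context {R : realType} (P : prob R).

Lemma integrable_sqr (m : R) : (\int[P]_x (x ^+ 2)%:E = m%:E)%E ->
  P.-integrable setT (EFin \o (fun x : R => x ^+ 2)).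
Proof.
move=> Pm; apply/integrableP; split; first exact/measurable_EFinP.
under eq_integral do rewrite /= ger0_norm ?sqr_ge0//.
by rewrite Pm ltry.
Qed.

Lemma integral_sqr_kernel (s : R) : 0 < s ->
  (\int[P]_x (x ^+ 2 * (x ^+ 2 + s)^-1)%:E = (1 - s * stieltjes P s)%:E)%E.
Proof.
move=> s0; have ki := kernel_integrable P s s0.
transitivity (\int[P]_x ((cst 1 x)%:E - s%:E * ((x ^+ 2 + s)^-1)%:E))%E.
  apply: eq_integral => x _; rewrite -EFinM -EFinB; congr EFin => /=.
  have xs : 0 < x ^+ 2 + s by rewrite ltr_wpDl ?sqr_ge0.
  by field; rewrite gt_eqF.
rewrite integralB//=; last 2 first.
- exact: finite_measure_integrable_cst.
- exact: integrableZl.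
by rewrite integral_cst1 integralZl// stieltjesE.
Qed.

(** With [t = x ^ 2], dividing [(t - c) ^ 2] by [t + s] gives quotient [t - (2 c + s)] and remainder
    [(c + s) ^ 2]. *)
Lemma integral_sqrB_kernel (m c s : R) : 0 < s ->
  (\int[P]_x (x ^+ 2)%:E = m%:E)%E ->
  (\int[P]_x ((x ^+ 2 - c) ^+ 2 * (x ^+ 2 + s)^-1)%:E =
    (m - (c *+ 2 + s) + (c + s) ^+ 2 * stieltjes P s)%:E)%E.
Proof.
move=> s0 Pm; have ki := kernel_integrable P s s0.
have i2 := integrable_sqr _ Pm.
transitivity (\int[P]_x ((x ^+ 2)%:E - (cst (c *+ 2 + s) x)%:E +
                         ((c + s) ^+ 2)%:E * ((x ^+ 2 + s)^-1)%:E))%E.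
  apply: eq_integral => x _; rewrite -EFinM -EFinB -EFinD; congr EFin => /=.
  have xs : 0 < x ^+ 2 + s by rewrite ltr_wpDl ?sqr_ge0.
  by field; rewrite gt_eqF.
have ci : P.-integrable setT (EFin \o cst (c *+ 2 + s)).
  exact: finite_measure_integrable_cst.
have iB := integrableB measurableT i2 ci.
have iZ := integrableZl measurableT ((c + s) ^+ 2) ki.
etransitivity; first exact: (integralD measurableT iB iZ).
rewrite [RHS]EFinD; congr (_ + _)%E.
  etransitivity; first exact: (integralB measurableT i2 ci).
  by rewrite /= Pm integral_cst1.
by rewrite integralZl//= stieltjesE.
Qed.

Lemma stieltjes_le_moment (M s : R) : 0 < s -> moment P (- 2) = M%:E ->
  stieltjes P s <= M.
Proof.
move=> s0 PM; rewrite -lee_fin -stieltjesE// -PM.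
apply: ge0_le_integral => //.
- by move=> x _; rewrite lee_fin kernel_ge0.
- by apply/measurable_EFinP; exact: measurable_inv_sqrD.
- exact: measurable_epowzN2.
- move=> x _; rewrite epowzN2E; case: ifPn => [_|x0]; first exact: leey.
  have x20 : 0 < x ^+ 2 by rewrite exprn_even_gt0.
  by rewrite lee_fin lef_pV2 ?posrE ?lerDl ?ltW// ltr_wpDl// ltW.
Qed.

End moments.

(** * Moment bounds for a Boolean power [Q] of order [N] *)

Section power_bounds.
Context {R : realType} (mu Q : prob R) (N V : R).
Hypothesis N1 : 1 <= N.
Hypothesis QE : forall s : R, 0 < s ->
  (stieltjes Q s)^-1 = s + N * ((stieltjes mu s)^-1 - s).
Hypothesis mu2 : (\int[mu]_x (x ^+ 2)%:E = 1)%E.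
Hypothesis muV : (\int[mu]_x ((x ^+ 2 - 1) ^+ 2)%:E = V%:E)%E.

(* [h] is the K-transform of [mu] on the imaginary axis: at [z = i sqrt s] one
   has [K mu z = h s / z]. *)
Let h (s : R) : R := (stieltjes mu s)^-1 - s.

Let stieltjes_h (s : R) : 0 < s -> stieltjes mu s = (s + h s)^-1.
Proof. by move=> s0; rewrite /h addrC subrK invrK. Qed.

Let stieltjes_Nh (s : R) : 0 < s -> stieltjes Q s = (s + N * h s)^-1.
Proof. by move=> s0; rewrite -QE// invrK. Qed.

Let h_ge0 (s : R) : 0 < s -> 0 <= h s.
Proof.
move=> s0; rewrite subr_ge0 -[leLHS]invrK lef_pV2 ?posrE ?invr_gt0//.
  exact: stieltjes_le.
exact: stieltjes_gt0.
Qed.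

(* Positivity of the left-hand side gives [h s <= 1]; multiplying by [s] and
   comparing with [V] gives [s * (1 - h s) <= V]. *)
Let kernel_muE (s : R) : 0 < s ->
  (\int[mu]_x ((x ^+ 2 - 1) ^+ 2 * (x ^+ 2 + s)^-1)%:E =
    ((1 + s) * (1 - h s) / (s + h s))%:E)%E.
Proof.
move=> s0; rewrite (integral_sqrB_kernel _ 1)//; congr EFin.
have := h_ge0 s s0; rewrite stieltjes_h// => h0.
have sh : 0 < s + h s by rewrite ltr_wpDr.
by field; rewrite gt_eqF.
Qed.

Let h_le1 (s : R) : 0 < s -> h s <= 1.
Proof.
move=> s0; have h0 := h_ge0 s s0.
have : (0 <= ((1 + s) * (1 - h s) / (s + h s))%:E)%E.
  rewrite -kernel_muE//; apply: integral_ge0 => x _; rewrite lee_fin.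
  by rewrite mulr_ge0 ?sqr_ge0// kernel_ge0.
have sh : 0 < s + h s by rewrite ltr_wpDr.
by rewrite lee_fin pmulr_lge0 ?invr_gt0// pmulr_rge0 ?subr_ge0// addr_gt0.
Qed.

Let h_near1 (s : R) : 0 < s -> s * (1 - h s) <= V.
Proof.
move=> s0; have h0 := h_ge0 s s0; have h1 := h_le1 s s0.
have sh : 0 < s + h s by rewrite ltr_wpDr.
have : ((s * ((1 + s) * (1 - h s) / (s + h s)))%:E <= V%:E)%E.
  rewrite EFinM -kernel_muE// -muV -ge0_integralZl//; last 3 first.
  - apply/measurable_EFinP/measurable_funM; last exact: measurable_inv_sqrD.
    exact/measurable_funX/measurable_funB.
  - by move=> x _; rewrite lee_fin mulr_ge0 ?sqr_ge0// kernel_ge0.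
  - by rewrite lee_fin ltW.
  apply: ge0_le_integral => //.
  - move=> x _; apply: mule_ge0; rewrite lee_fin; first exact: ltW.
    by rewrite mulr_ge0 ?sqr_ge0// kernel_ge0.
  - apply/measurable_EFinP/measurable_funM => //.
    apply/measurable_funM; last exact: measurable_inv_sqrD.
    exact/measurable_funX/measurable_funB.
  - exact/measurable_EFinP/measurable_funX/measurable_funB.
  move=> x _; rewrite -EFinM lee_fin mulrCA ler_piMr ?sqr_ge0//.
  by rewrite ler_pdivrMr ?mul1r ?lerDr ?sqr_ge0// ltr_wpDl ?sqr_ge0.
(* Since [h s <= 1], one has [s + h s <= 1 + s], so the fraction is at least [1 - h s]. *)
rewrite lee_fin; apply: le_trans.
rewrite mulrA ler_pdivlMr// mulrCA mulrA -mulrA [leRHS]mulrC -!mulrA.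
by have := mulr_ge0 (ltW s0) (_ : 0 <= 1 - h s); nra.
Qed.

(** The truncated second moment at level [k] equals [k N h / (k + N h)], which is at most [N]
    because [0 <= h <= 1]. *)
Lemma second_moment_le : (\int[Q]_x (x ^+ 2)%:E <= N%:E)%E.
Proof.
apply: (@fatou_cvg _ Q
    (fun n (x : R) => (x ^+ 2 * (n.+1%:R * (x ^+ 2 + n.+1%:R)^-1))%:E)).
- move=> n; apply/measurable_EFinP/measurable_funM => //.
  by apply: measurable_funM => //; exact: measurable_inv_sqrD.
- by move=> n x; rewrite lee_fin mulr_ge0 ?sqr_ge0// mulr_ge0// kernel_ge0.
- by move=> x; exact: cvg_kernel1.
apply: nearW => n; set k : R := n.+1%:R.
have k0 : 0 < k by rewrite ltr0n.
clearbody k.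
have h0 := h_ge0 k k0; have h1 := h_le1 k k0.
have kh : 0 < k + N * h k by rewrite ltr_wpDr ?mulr_ge0// (le_trans ler01).
under eq_integral do rewrite mulrCA EFinM.
rewrite ge0_integralZl//; last 3 first.
- by apply/measurable_EFinP/measurable_funM => //; exact: measurable_inv_sqrD.
- by move=> x _; rewrite lee_fin mulr_ge0 ?sqr_ge0// kernel_ge0.
- by rewrite lee_fin ltW.
rewrite integral_sqr_kernel// -EFinM lee_fin stieltjes_Nh//.
rewrite (_ : k * (1 - _) = k * (N * h k) / (k + N * h k)); last first.
  by field; rewrite gt_eqF.
rewrite ler_pdivrMr//.
have : 0 <= N * k * (1 - h k).
  by rewrite !mulr_ge0 ?subr_ge0 ?(ltW k0)// (le_trans ler01).
have : 0 <= N * N * h k by rewrite !mulr_ge0// (le_trans ler01).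
by lra.
Qed.

Lemma sqr_variance_le :
  (\int[Q]_x ((x ^+ 2 - N) ^+ 2)%:E <= (2 * N * V)%:E)%E.
Proof.
have N0 : 0 <= N by rewrite (le_trans ler01).
(* [integral_sqrB_kernel] asks for a finite second moment; the bound just proved supplies it. *)
have Q2fin : (\int[Q]_x (x ^+ 2)%:E)%E \is a fin_num.
  rewrite ge0_fin_numE; first by rewrite (le_lt_trans second_moment_le)// ltry.
  by apply: integral_ge0 => x _; rewrite lee_fin sqr_ge0.
pose m := fine (\int[Q]_x (x ^+ 2)%:E)%E.
have Q2 : (\int[Q]_x (x ^+ 2)%:E = m%:E)%E by rewrite fineK.
have mN : m <= N by rewrite -lee_fin -Q2 second_moment_le.
apply: (@fatou_cvg _ Q
    (fun n (x : R) => ((x ^+ 2 - N) ^+ 2 * (n.+1%:R * (x ^+ 2 + n.+1%:R)^-1))%:E)).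
- move=> n; apply/measurable_EFinP/measurable_funM.
    exact/measurable_funX/measurable_funB.
  by apply: measurable_funM => //; exact: measurable_inv_sqrD.
- by move=> n x; rewrite lee_fin mulr_ge0 ?sqr_ge0// mulr_ge0// kernel_ge0.
- by move=> x; exact: cvg_kernel1.
(* Levels [k >= N] suffice for Fatou; they give [N + k <= 2 k], the source of the factor 2. *)
have : \forall n \near \oo, N <= n.+1%:R.
  near=> n; rewrite (@le_trans _ _ n%:R)// ?ler_nat//.
  by near: n; exact: nbhs_infty_ger.
apply: filterS => n; set k : R := n.+1%:R => Nk.
have k0 : 0 < k by rewrite ltr0n.
clearbody k.
have h0 := h_ge0 k k0; have h1 := h_le1 k k0.
have kh : 0 < k + N * h k by rewrite ltr_wpDr ?mulr_ge0.
under eq_integral do rewrite mulrCA EFinM.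
rewrite ge0_integralZl//; last 3 first.
- apply/measurable_EFinP/measurable_funM; last exact: measurable_inv_sqrD.
  exact/measurable_funX/measurable_funB.
- by move=> x _; rewrite lee_fin mulr_ge0 ?sqr_ge0// kernel_ge0.
- by rewrite lee_fin ltW.
rewrite (integral_sqrB_kernel _ m)// -EFinM lee_fin stieltjes_Nh//.
(* Replacing [m] by its upper bound [N] makes the expression factor; the middle factor is at most 2
   and the last at most [V]. *)
apply: (@le_trans _ _ (N * ((N + k) / (k + N * h k)) * (k * (1 - h k)))).
  rewrite (_ : N * _ * _ = k * (N - (N *+ 2 + k) + (N + k) ^+ 2 / (k + N * h k))).
    by rewrite ler_pM2l// !lerD2r.
  by field; rewrite gt_eqF.
have V0 := h_near1 k k0.
have khN : (N + k) / (k + N * h k) <= 2.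
  by rewrite ler_pdivrMr//; have := mulr_ge0 N0 h0; lra.
have k0' := ltW k0; have kh' := ltW kh.
apply: ler_pM => //.
- by rewrite mulr_ge0// divr_ge0// addr_ge0.
- by rewrite mulr_ge0// subr_ge0.
- by rewrite mulrC ler_wpM2r.
Unshelve. all: by end_near. Qed.

(** For small [s], [1 / S_Q(s)] is at least [N (1 / S_mu(s) - s)], and [1 / S_mu(s) >= 1 / M]; Fatou
    then lets [s] tend to 0. *)
Lemma moment_N2_le (M : R) : moment mu (- 2) = M%:E ->
  (moment Q (- 2) <= (2 * M / N)%:E)%E.
Proof.
move=> muM; have N0 : 0 < N by rewrite (lt_le_trans ltr01).
have M0 : 0 < M.
  apply: lt_le_trans (stieltjes_gt0 mu 1 ltr01) _.
  exact: stieltjes_le_moment.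
apply: (@fatou_cvg _ Q (fun n (x : R) => ((x ^+ 2 + harmonic n)^-1)%:E)).
- move=> n; apply/measurable_EFinP; apply: measurable_inv_sqrD.
  exact: harmonic_gt0.
- by move=> n x; rewrite lee_fin kernel_ge0// harmonic_gt0.
- by move=> x; exact: cvg_epowzN2.
(* With [s <= 1 / (2 M)], at least half of [1 / M] remains after subtracting [s]. *)
have : \forall n \near \oo, harmonic n <= (2 * M)^-1 :> R.
  have := @cvg_harmonic R; move/cvgrPdist_le => /(_ (2 * M)^-1).
  rewrite invr_gt0 mulr_gt0// => /(_ isT); apply: filterS => n.
  by rewrite sub0r normrN gtr0_norm ?harmonic_gt0.
apply: filterS => n; have s0 : 0 < harmonic n :> R := harmonic_gt0 n.
move: s0; set s : R := harmonic n => s0 sM.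
rewrite stieltjesE// lee_fin -[leLHS]invrK QE// -[leRHS]invf_div.
have SM := stieltjes_le_moment _ _ _ s0 muM.
have Sinv : M^-1 <= (stieltjes mu s)^-1 by rewrite lef_pV2 ?posrE ?stieltjes_gt0.
rewrite lef_pV2 ?posrE; last 2 first.
- by rewrite -QE// invr_gt0 stieltjes_gt0.
- by rewrite divr_gt0// mulr_gt0.
have : N * (M^-1 - (2 * M)^-1) <= N * ((stieltjes mu s)^-1 - s).
  by rewrite ler_pM2l// lerB.
rewrite (_ : N * _ = N / (2 * M)); last by field; rewrite gt_eqF.
by move=> /le_trans; apply; rewrite lerDr ltW.
Qed.

End power_bounds.

(** * Logarithmic inequalities and the entropy estimate *)

Lemma measurable_lne_norm (R : realType) :
  measurable_fun setT (fun x : R => lne (`|x|%:E)).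
Proof.
apply: measurable_fun_ifT => //; first exact: measurable_fun_ler.
by apply/measurable_EFinP; exact: measurableT_comp.
Qed.

(** Everything comes from [ln y <= y - 1] at [y = t], [1 / t] and [1 / (l t)]. The free parameter
    [l] trades a factor [ln l] on the quadratic term for a factor [1 / l] on [1 / t]. *)
Lemma ln_norm_bounds (R : realType) (x l : R) : x != 0 -> 1 <= l ->
  let t := x ^+ 2 in
  [/\ `|ln `|x| | <= t + t^-1, ln `|x| <= (t - 1) / 2 &
      (t - 1) / 2 - ln `|x| <= (1 + 2 * ln l) * (t - 1) ^+ 2 + (2 * l)^-1 * t^-1].
Proof.
move=> x0 l1 t.
have ln_le (y : R) : 0 < y -> ln y <= y - 1.
  by move=> y0; rewrite -{1}(subrK 1 y) addrC le_ln1Dx// ltrBrDr addNr.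
have t0 : 0 < t by rewrite exprn_even_gt0.
have l0 : 0 < l by rewrite (lt_le_trans ltr01).
have lnt : ln t = 2 * ln `|x|.
  by rewrite /t -(real_normK (num_real x)) lnXn ?normr_gt0// mulr_natl.
have lnl : 0 <= ln l by rewrite ln_ge0.
have tV0 : 0 < t^-1 by rewrite invr_gt0.
have u1 := ln_le _ t0.
have u2 := ln_le _ tV0; rewrite lnV ?posrE// in u2.
have lt0 : 0 < (l * t)^-1 by rewrite invr_gt0 mulr_gt0.
have u3 : - (ln l + ln t) <= (l * t)^-1 - 1.
  have lt1 : 0 < l * t by rewrite mulr_gt0.
  by rewrite -lnM ?posrE// -lnV ?posrE//; exact: ln_le.
split.
- by rewrite ler_norml; lra.
- by lra.
have [t2|t2] := lerP t 2^-1.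
  (* For [t <= 1/2], the factor [4 (t - 1) ^ 2 >= 1] absorbs [ln l], and the rest of [- ln t] is at
     most [1 / (l t) - 1]. *)
  have sq : 1 <= 4 * (t - 1) ^+ 2 by nra.
  have : ln l <= ln l * (4 * (t - 1) ^+ 2) by rewrite ler_peMr.
  have : 0 <= (t - 1) ^+ 2 by rewrite sqr_ge0.
  rewrite invfM -mulrA -invfM; move: lt0 u3; move: (l * t)^-1 => w.
  by lra.
have : 0 < (2 * l)^-1 * t^-1 by rewrite mulr_gt0// invr_gt0 mulr_gt0.
have : 0 <= ln l * (t - 1) ^+ 2 by rewrite mulr_ge0// sqr_ge0.
(* For [t > 1/2], [- ln t <= 1 / t - 1] bounds the integrand by [(t - 1) ^ 2 / (2 t)], and
   [1 / t < 2]. *)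
have : 0 <= (2 - t^-1) * (t - 1) ^+ 2.
  rewrite mulr_ge0 ?sqr_ge0// subr_ge0 -[leRHS]invrK.
  by rewrite lef_pV2 ?posrE ?invr_gt0 ?ltr0n// ltW.
rewrite (_ : (2 - t^-1) * _ = 2 * (t - 1) ^+ 2 - (t - 2 + t^-1)); last first.
  by field; rewrite gt_eqF.
by lra.
Qed.

Local Arguments epowz : simpl never.
Local Arguments lne : simpl never.

Section entropy.
Context {R : realType} (P : prob R) (m l A B : R).
Hypothesis l1 : 1 <= l.
Hypothesis P2 : (\int[P]_x (x ^+ 2)%:E = m%:E)%E.
Hypothesis PA : (\int[P]_x ((x ^+ 2 - 1) ^+ 2)%:E <= A%:E)%E.
Hypothesis PB : (moment P (- 2) <= B%:E)%E.

(** The majorant is [x ^ 2 + x ^ (-2)], which is [+oo] at 0, where the logarithm is [-oo]. *)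
Lemma integrable_lne_norm :
  P.-integrable setT (fun x : R => lne (`|x|%:E)).
Proof.
have iN2 : P.-integrable setT (fun x : R => epowz x (- 2)).
  apply/integrableP; split; first exact: measurable_epowzN2.
  under eq_integral do rewrite gee0_abs ?epowzN2_ge0//.
  exact: le_lt_trans PB (ltry _).
apply: (le_integrable measurableT _ _
  (integrableD measurableT (integrable_sqr _ _ P2) iN2)).
  exact: measurable_lne_norm.
move=> x _ /=; rewrite [leRHS]gee0_abs; last first.
  by rewrite adde_ge0 ?epowzN2_ge0// lee_fin sqr_ge0.
rewrite epowzN2E; have [_|x0] := eqVneq x 0; first by rewrite addey// leey.
have [H _ _] := ln_norm_bounds _ x _ x0 l1.
by rewrite lne_EFin ?normr_gt0//= lee_fin.
Qed.

Lemma boolean_entropy_bounds :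
  (0 <= boolean_entropy P <= ((1 + 2 * ln l) * A + (2 * l)^-1 * B)%:E)%E.
Proof.
pose f (x : R) := (x ^+ 2 - 1) / 2.
have ic : P.-integrable setT (EFin \o cst 1).
  exact: finite_measure_integrable_cst.
have i2 := integrable_sqr _ _ P2.
have ifE : (\int[P]_x (f x)%:E = ((m - 1) / 2)%:E)%E.
  transitivity (\int[P]_x (2^-1%:E * ((x ^+ 2)%:E - (cst 1 x)%:E)))%E.
    by apply: eq_integral => x _; rewrite -EFinB -EFinM /f mulrC.
  have iB := integrableB measurableT i2 ic.
  etransitivity; first exact: (integralZl measurableT iB).
  have -> := integralB measurableT i2 ic.
  by rewrite /= P2 integral_cst1 -EFinB -EFinM mulrC.
have fint : P.-integrable setT (EFin \o f).
  have := integrableZl measurableT 2^-1 (integrableB measurableT i2 ic).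
  apply: eq_integrable => // x _ /=.
  by rewrite -EFinB -EFinM /f mulrC.
have iL := integrable_lne_norm.
(* Both terms being integrable, the entropy merges into one integral with no difference of
   infinities. *)
have GE : boolean_entropy P = (\int[P]_x ((f x)%:E - lne (`|x|%:E)))%E.
  rewrite (integralB measurableT fint iL) /= ifE /boolean_entropy.
  have -> : moment P 2 = m%:E by exact: P2.
  have := integrable_fin_num measurableT iL.
  case: (integral _ _ _) => // L _.
  by rewrite -EFinM -!EFinB; congr EFin; lra.
have fL (x : R) : (0 <= (f x)%:E - lne (`|x|%:E))%E.
  have [->|x0] := eqVneq x 0; first by rewrite normr0 le0_lneNy//= addey// leey.
  have [_ H _] := ln_norm_bounds _ x _ x0 l1.
  by rewrite lne_EFin ?normr_gt0// -EFinB lee_fin subr_ge0.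
rewrite GE; apply/andP; split; first exact: integral_ge0.
have lnl : 0 <= ln l by rewrite ln_ge0.
have c0 : 0 <= 1 + 2 * ln l by rewrite addr_ge0 ?mulr_ge0.
have l0 : 0 < l by rewrite (lt_le_trans ltr01).
have d0 : 0 <= (2 * l)^-1 by rewrite invr_ge0 mulr_ge0// ltW.
have mA : measurable_fun setT (fun x : R => ((x ^+ 2 - 1) ^+ 2)%:E).
  exact/measurable_EFinP/measurable_funX/measurable_funB.
have mB := @measurable_epowzN2 R.
apply: (@le_trans _ _ (\int[P]_x ((1 + 2 * ln l)%:E * ((x ^+ 2 - 1) ^+ 2)%:E +
                                   (2 * l)^-1%:E * epowz x (- 2)))%E).
  apply: ge0_le_integral => //.
  - by apply: emeasurable_funB; [case/integrableP: fint|exact: measurable_lne_norm].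
  - by apply: emeasurable_funD; exact: measurable_funeM.
  (* At [x = 0] the majorant is [+oo], as the coefficient [1 / (2 l)] is positive. *)
  move=> x _; rewrite epowzN2E; have [_|x0] := eqVneq x 0.
    by rewrite gt0_muley ?lte_fin ?invr_gt0 ?mulr_gt0// addey// leey.
  have [_ _ H] := ln_norm_bounds _ x _ x0 l1.
  by rewrite lne_EFin ?normr_gt0// -!EFinM -EFinB -EFinD lee_fin.
rewrite ge0_integralD//; last 4 first.
- by move=> x _; rewrite mule_ge0 ?lee_fin ?sqr_ge0.
- exact: measurable_funeM.
- by move=> x _; rewrite mule_ge0 ?lee_fin ?epowzN2_ge0.
- exact: measurable_funeM.
rewrite !ge0_integralZl//; last 2 first.
- by move=> x _; exact: epowzN2_ge0.
- by move=> x _; rewrite lee_fin sqr_ge0.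
apply: (le_trans (leeD (lee_wpmul2l _ PA) (lee_wpmul2l _ PB))).
- by rewrite lee_fin.
- by rewrite lee_fin.
- by rewrite -!EFinM -EFinD.
Qed.

End entropy.

(** * Scaling of the moments under dilation *)

Lemma dilation_moments (R : realType) (Q : prob R) (N : R) : 0 < N ->
  let D := dilation (1 / Num.sqrt N) Q in
  [/\ (\int[D]_x (x ^+ 2)%:E = N^-1%:E * \int[Q]_x (x ^+ 2)%:E)%E,
      (\int[D]_x ((x ^+ 2 - 1) ^+ 2)%:E =
        (N ^- 2)%:E * \int[Q]_x ((x ^+ 2 - N) ^+ 2)%:E)%E &
      (moment D (- 2) = N%:E * moment Q (- 2))%E].
Proof.
move=> N0 D.
have sq (x : R) : ((Num.sqrt N)^-1 * x) ^+ 2 = N^-1 * x ^+ 2.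
  by rewrite exprMn exprVn sqr_sqrtr// ltW.
have mB (c : R) : measurable_fun setT (fun x : R => ((x ^+ 2 - c) ^+ 2)%:E).
  exact/measurable_EFinP/measurable_funX/measurable_funB.
split.
- rewrite ge0_integral_distribution//=; last 2 first.
  + exact/measurable_EFinP.
  + by move=> y; rewrite lee_fin sqr_ge0.
  under eq_integral do rewrite /scale div1r sq EFinM.
  rewrite ge0_integralZl ?lee_fin ?invr_ge0 ?(ltW N0)//.
  + exact/measurable_EFinP.
  + by move=> y _; rewrite lee_fin sqr_ge0.
- rewrite ge0_integral_distribution//=; last 2 first.
  + exact: mB.
  + by move=> y; rewrite lee_fin sqr_ge0.
  rewrite -ge0_integralZl ?lee_fin ?invr_ge0 ?sqr_ge0//; last 2 first.
  + exact: mB.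
  + by move=> y _; rewrite lee_fin sqr_ge0.
  apply: eq_integral => x _; rewrite /scale div1r sq -EFinM; congr EFin.
  by field; rewrite gt_eqF.
- rewrite /moment ge0_integral_distribution//=; last 2 first.
  + exact: measurable_epowzN2.
  + exact: epowzN2_ge0.
  rewrite -ge0_integralZl ?lee_fin ?(ltW N0)//; last 2 first.
  + exact: measurable_epowzN2.
  + by move=> y _; exact: epowzN2_ge0.
  apply: eq_integral => x _; rewrite /= !epowzN2E /scale.
  have s0 : Num.sqrt N != 0 by rewrite gt_eqF// sqrtr_gt0.
  rewrite mulf_eq0 div1r invr_eq0 (negbTE s0) /=.
  have [_|x0] := eqVneq x 0; first by rewrite gt0_muley.
  by rewrite -EFinM; congr EFin; rewrite sq invfM invrK.
Qed.

(** * The logarithmic rate for the rescaled Boolean powers *)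

Theorem corollary3p10 (R : realType) (mu : prob R) (nu : nat -> prob R)
    (mu_sym : symmetric_prob mu)
    (mu_m1 : moment mu 1 = 0%E)
    (mu_m2 : moment mu 2 = 1%E)
    (mu_m4 : (moment mu 4 < +oo)%E)
    (mu_mN2 : (moment mu (- 2) < +oo)%E)
    (nu_powers : is_boolean_powers mu nu) :
  let Gamma (n : nat) : \bar R :=
    boolean_entropy (dilation (1 / Num.sqrt n%:R) (nu n)) in
  (\forall n \near \oo, Gamma n \is a fin_num) /\
  (fun n : nat => fine (Gamma n) : R) =O_\oo
    (fun n : nat => ln (n%:R : R) / n%:R).
Proof.
move=> Gamma.
have mu2 : (\int[mu]_x (x ^+ 2)%:E = 1%E)%E by exact: mu_m2.
pose V := fine (\int[mu]_x ((x ^+ 2 - 1) ^+ 2)%:E)%E.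
have mB : measurable_fun setT (fun x : R => ((x ^+ 2 - 1) ^+ 2)%:E).
  exact/measurable_EFinP/measurable_funX/measurable_funB.
have muV : (\int[mu]_x ((x ^+ 2 - 1) ^+ 2)%:E = V%:E)%E.
  rewrite fineK// ge0_fin_numE; last first.
    by apply: integral_ge0 => x _; rewrite lee_fin sqr_ge0.
  (* [(x ^ 2 - 1) ^ 2 <= x ^ 4 + 1], so the fourth moment controls [V]. *)
  have m4 : (\int[mu]_x ((x ^+ 4)%:E + (cst 1 x)%:E) < +oo)%E.
    rewrite ge0_integralD//; last 3 first.
    - by move=> x _; rewrite lee_fin exprn_even_ge0.
    - exact/measurable_EFinP.
    - exact/measurable_EFinP.
    by rewrite lte_add_pinfty//= integral_cst1 ltry.
  apply: le_lt_trans m4; apply: ge0_le_integral => //.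
  - by move=> x _; rewrite lee_fin sqr_ge0.
  - by apply: emeasurable_funD => //; exact/measurable_EFinP.
  - by move=> x _; rewrite -EFinD lee_fin /=; have := sqr_ge0 x; nra.
pose M := fine (moment mu (- 2)).
have muM : moment mu (- 2) = M%:E.
  rewrite fineK// ge0_fin_numE//; apply: integral_ge0 => x _.
  exact: epowzN2_ge0.
have M0 : 0 < M.
  apply: lt_le_trans (stieltjes_gt0 mu 1 ltr01) _.
  exact: stieltjes_le_moment.
have V0 : 0 <= V.
  by rewrite -lee_fin -muV; apply: integral_ge0 => x _; rewrite lee_fin sqr_ge0.
have bound (n : nat) : (0 < n)%N ->
    (0 <= Gamma n <= ((1 + 2 * ln n%:R) * (2 * V / n%:R) + M / n%:R)%:E)%E.
  case: n => // n _; set N : R := n.+1%:R.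
  have N1 : 1 <= N by rewrite ler1n.
  have N0 : 0 < N by rewrite ltr0n.
  have QE := stieltjes_powers mu nu mu_sym nu_powers n.
  have [D2 D4 DN2] := dilation_moments _ (nu n.+1) _ N0.
  have Q2 := second_moment_le _ (nu n.+1) _ N1 QE mu2.
  have Q4 := sqr_variance_le _ (nu n.+1) _ _ N1 QE mu2 muV.
  have QN2 := moment_N2_le _ (nu n.+1) _ N1 QE _ muM.
  have Q2fin : (\int[nu n.+1]_x (x ^+ 2)%:E)%E \is a fin_num.
    rewrite ge0_fin_numE; first by rewrite (le_lt_trans Q2)// ltry.
    by apply: integral_ge0 => x _; rewrite lee_fin sqr_ge0.
  (* This is the shape of [boolean_entropy_bounds] with [l = N], [A = 2 V / N] and [B = 2 M]. *)
  have -> : (1 + 2 * ln N) * (2 * V / N) + M / N =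
            (1 + 2 * ln N) * (2 * V / N) + (2 * N)^-1 * (2 * M).
    by congr (_ + _); field; rewrite gt_eqF.
  apply: boolean_entropy_bounds => //.
  - by rewrite D2 -(fineK Q2fin) -EFinM.
  - rewrite D4; apply: le_trans (lee_wpmul2l _ Q4) _.
      by rewrite lee_fin invr_ge0 sqr_ge0.
    rewrite -EFinM lee_fin le_eqVlt; apply/orP; left; apply/eqP.
    by field; rewrite gt_eqF.
  - rewrite DN2; apply: le_trans (lee_wpmul2l _ QN2) _.
      by rewrite lee_fin ltW.
    by rewrite -EFinM lee_fin mulrC divfK// gt_eqF.
have Gfin (n : nat) : (0 < n)%N -> Gamma n \is a fin_num.
  move=> /bound /andP[G0 GC].
  by rewrite ge0_fin_numE// (le_lt_trans GC)// ltry.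
split; first by exists 1%N => // n /= /Gfin.
have C0 : 0 < 8 * V + 2 * M by rewrite ltr_wpDl ?mulr_ge0 ?mulr_gt0.
(* From [1 <= 2 ln n] follow [(1 + 2 ln n) 2 V <= 8 V ln n] and [M <= 2 M ln n]. *)
apply/eqO_exP; exists (8 * V + 2 * M) => //.
exists 2%N => // n /= n2.
have n0 : (0 < n)%N by rewrite (leq_trans _ n2).
have /andP[] := bound _ n0; rewrite -(fineK (Gfin _ n0)) !lee_fin => G0 GC.
have nR : 0 < n%:R :> R by rewrite ltr0n.
(* [ln n = - ln (1 / n) >= 1 - 1 / n >= 1/2] for [n >= 2], hence the starting rank 2. *)
have ln1 : 1 <= 2 * ln (n%:R : R).
  have : ln (1 + (n%:R^-1 - 1)) <= n%:R^-1 - 1 :> R.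
    by rewrite le_ln1Dx// ltrBrDr addNr invr_gt0.
  rewrite addrC subrK lnV ?posrE//.
  have : n%:R^-1 <= 2^-1 :> R by rewrite lef_pV2 ?posrE// ler_nat.
  by lra.
have ln0 : 0 <= ln (n%:R : R) by lra.
rewrite (ger0_norm G0) ger0_norm; last by rewrite divr_ge0// ltW.
apply: (le_trans GC).
rewrite !mulrA -mulrDl ler_pM2r ?invr_gt0//.
have : V <= V * (2 * ln n%:R) by rewrite ler_peMr.
have : M <= M * (2 * ln n%:R) by rewrite ler_peMr// ltW.
by lra.
Qed.
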